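(* Fix $n>K\ge1$ and a nonrandom $n\times K$ design matrix $\mathbf{X}$ with rows $\mathbf{x}_i$ satisfying $\mathbf{X}^t\mathbf{X}=n\mathbf{I}$. Suppose $Y_i=\mathbf{x}_i^t\boldsymbol{\beta}_0+\varepsilon_i$, $i=1,\dots,n$, where $\varepsilon_i$ are i.i.d. $N(0,\sigma_0^2)$, $\sigma_0^2>0$, and $\boldsymbol{\beta}_0\in\mathbb{R}^K$ has $k_0$ nonzero coordinates with $1\le k_0<K$. Consider the rescaled spike and slab model with $\lambda_n=n$, with $\sigma^2\equiv1$ (i.e. $\mu\{\sigma^2=1\}=1$) and with $\boldsymbol{\beta}\sim N(\mathbf{0},\boldsymbol{\Gamma}_0)$, $\boldsymbol{\Gamma}_0=\mathrm{diag}(\gamma_{1,0},\dots,\gamma_{K,0})$, for a fixed hypervariance vector $\boldsymbol{\gamma}_0$ with positive entries. Then for each $0<\delta<1/2$ there exists such a $\boldsymbol{\gamma}_0$ for which $\mathcal{R}_Z(\alpha)<\mathcal{R}_O(\alpha)$ for all $\alpha\in[\delta,1-\delta]$.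
   Context: Let $\mathbf{Y}=(Y_1,\dots,Y_n)^t$, $\widehat{\boldsymbol{\beta}}_n^\circ=(\mathbf{X}^t\mathbf{X})^{-1}\mathbf{X}^t\mathbf{Y}=(\widehat\beta_{1,n}^\circ,\dots,\widehat\beta_{K,n}^\circ)^t$ (OLS) and $\widehat\sigma_n^2=\|\mathbf{Y}-\mathbf{X}\widehat{\boldsymbol{\beta}}_n^\circ\|^2/(n-K)$. Rescaled spike and slab model: $Y_i^*=\widehat\sigma_n^{-1}n^{1/2}Y_i$, and as data $\mathbf{Y}^*$ is modeled by $(Y_i^*\mid\boldsymbol{\beta},\sigma^2)$ independent $N(\mathbf{x}_i^t\boldsymbol{\beta},\sigma^2\lambda_n)$, with the stated priors on $\boldsymbol{\beta}$ and $\sigma^2$; $\widehat{\boldsymbol{\beta}}_n^*=(\widehat\beta_{1,n}^*,\dots,\widehat\beta_{K,n}^* )^t$ is the posterior mean of $\boldsymbol{\beta}$ given $\mathbf{Y}^*$. Let $s_{kk}$ be the $k$th diagonal entry of $(\mathbf{X}^t\mathbf{X}/n)^{-1}$ and $\widehat Z_{k,n}=n^{1/2}\widehat\beta_{k,n}^\circ/(\widehat\sigma_n s_{kk}^{1/2})$. Let $z_{\alpha/2}$ be the $100(1-\alpha/2)$ percentile of the standard normal distribution, and $\mathcal{B}_0=\{k:\beta_{k,0}=0\}$. Define $\mathcal{R}_Z(\alpha)=\sum_{k\in\mathcal{B}_0}\mathbb{P}\{|\widehat\beta_{k,n}^*|\ge z_{\alpha/2}\}+\sum_{k\notin\mathcal{B}_0}\mathbb{P}\{|\widehat\beta_{k,n}^*|<z_{\alpha/2}\}$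 and $\mathcal{R}_O(\alpha)=\sum_{k\in\mathcal{B}_0}\mathbb{P}\{|\widehat Z_{k,n}|\ge z_{\alpha/2}\}+\sum_{k\notin\mathcal{B}_0}\mathbb{P}\{|\widehat Z_{k,n}|<z_{\alpha/2}\}$, probabilities taken under the true model. *)

(* Defs.v *)
From HB Require Import structures.
From mathcomp Require Import all_boot all_order all_algebra.
From mathcomp Require Import all_classical all_reals all_analysis.
From mathcomp Require Import normal_distribution.
Set Implicit Arguments. Unset Strict Implicit. Unset Printing Implicit Defensive.
Import Order.TTheory GRing.Theory Num.Theory.
Local Open Scope classical_set_scope.
Local Open Scope ring_scope.

Section Defs.
Variable R : realType.

Definition upd (e : nat -> R) (j : nat) (t : R) : nat -> R :=
  fun i => if i == j then t else e i.

(* Iterated Lebesgue integral over the first m coordinates (0..m-1) of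
   R^nat, i.e. the integral over R^m (Fubini-Tonelli); the other
   coordinates are frozen at those of the base point e. *)
Fixpoint iter_int (m : nat) (f : (nat -> R) -> \bar R) (e : nat -> R)
  : \bar R :=
  match m with
  | 0 => f e
  | m'.+1 => (\int[@lebesgue_measure R]_(t in [set: R])
                iter_int m' f (upd e m' t))%E
  end.

(* Law of the true model: probability that the noise vector
   (eps_0,...,eps_{n-1}), i.i.d. N(0, sigma0^2), lies in A. *)
Definition noise_prob (n : nat) (sigma0 : R) (A : set (nat -> R)) : \bar R :=
  iter_int n (fun e => ((\1_A e) * \prod_(i < n) normal_pdf 0 sigma0 (e i))%:E)
    (fun _ => 0).

Definition resp n K (X : 'M[R]_(n, K)) (beta0 : 'cV[R]_K) (e : nat -> R)
  : 'cV[R]_n := \col_i ((X *m beta0) i 0 + e i).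

Definition ols n K (X : 'M[R]_(n, K)) (Y : 'cV[R]_n) : 'cV[R]_K :=
  invmx (X^T *m X) *m X^T *m Y.

Definition sigma_hat n K (X : 'M[R]_(n, K)) (Y : 'cV[R]_n) : R :=
  Num.sqrt ((\sum_(i < n) ((Y - X *m ols X Y) i 0) ^+ 2) / (n - K)%:R).

Definition s_diag n K (X : 'M[R]_(n, K)) (k : 'I_K) : R :=
  invmx ((n%:R)^-1 *: (X^T *m X)) k k.

Definition Zstat n K (X : 'M[R]_(n, K)) (Y : 'cV[R]_n) (k : 'I_K) : R :=
  Num.sqrt n%:R * ols X Y k 0 / (sigma_hat X Y * Num.sqrt (s_diag X k)).

Definition rescaled n K (X : 'M[R]_(n, K)) (Y : 'cV[R]_n) : 'cV[R]_n :=
  ((sigma_hat X Y)^-1 * Num.sqrt n%:R) *: Y.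

(* Unnormalised joint density of (Y*, beta) in the rescaled spike and slab
   model with sigma^2 = 1 (point-mass prior), lambda_n = n, and
   beta ~ N(0, diag(gamma)):
   prod_i N(x_i^t beta, sigma^2 lambda_n)(y*_i) * prod_k N(0,gamma_k)(beta_k). *)
Definition joint_dens n K (X : 'M[R]_(n, K)) (gamma : 'I_K -> R)
  (ystar : 'cV[R]_n) (b : nat -> R) : R :=
  (\prod_(i < n) normal_pdf ((X *m \col_(j < K) b j) i 0)
                            (Num.sqrt (1 * n%:R)) (ystar i 0))
  * \prod_(k < K) normal_pdf 0 (Num.sqrt (gamma k)) (b k).

Definition post_mean n K (X : 'M[R]_(n, K)) (gamma : 'I_K -> R)
  (ystar : 'cV[R]_n) (k : 'I_K) : R :=
  fine (iter_int K (fun b => (b k * joint_dens X gamma ystar b)%:E) (fun _ => 0))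
  / fine (iter_int K (fun b => (joint_dens X gamma ystar b)%:E) (fun _ => 0)).

Definition beta_star n K (X : 'M[R]_(n, K)) (beta0 : 'cV[R]_K)
  (gamma : 'I_K -> R) (e : nat -> R) (k : 'I_K) : R :=
  post_mean X gamma (rescaled X (resp X beta0 e)) k.

Definition std_normal_cdf (z : R) : R :=
  fine (normal_prob 0 1 `]-oo, z]).
Definition std_normal_quantile (p : R) : R :=
  inf [set z : R | p <= std_normal_cdf z].
Definition z_half (alpha : R) : R := std_normal_quantile (1 - alpha / 2).

Local Open Scope ereal_scope.

Definition risk_Z n K (X : 'M[R]_(n, K)) (beta0 : 'cV[R]_K) (sigma0 : R)
  (gamma : 'I_K -> R) (alpha : R) : \bar R :=
  \sum_(k < K | (beta0 k 0 == 0)%R)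
     noise_prob n sigma0 [set e | z_half alpha <= `|beta_star X beta0 gamma e k|]%R
  + \sum_(k < K | (beta0 k 0 != 0)%R)
     noise_prob n sigma0 [set e | `|beta_star X beta0 gamma e k| < z_half alpha]%R.

Definition risk_O n K (X : 'M[R]_(n, K)) (beta0 : 'cV[R]_K) (sigma0 : R)
  (alpha : R) : \bar R :=
  \sum_(k < K | (beta0 k 0 == 0)%R)
     noise_prob n sigma0 [set e | z_half alpha <= `|Zstat X (resp X beta0 e) k|]%R
  + \sum_(k < K | (beta0 k 0 != 0)%R)
     noise_prob n sigma0 [set e | `|Zstat X (resp X beta0 e) k| < z_half alpha]%R.

End Defs.

(* Main.v *)
(* Gaussian conjugacy and X^t X = n I give beta*_k = d_k Z_k with
   d_k = gamma_k / (1 + gamma_k) in ]0, 1[.  Over alpha in [delta, 1 - delta] the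
   threshold z stays in some [a, b] with 0 < a.  For a null coordinate, letting
   d_k -> 0 turns P(|Z_k| >= z) >= P(|Z_k| >= b) > 0 into at most
   P(|Z_k| >= a / d_k) -> 0, a gain bounded below uniformly in z.  For a non-null
   coordinate, letting d_k -> 1 costs P(z <= |Z_k| < z / d_k), which tends to 0
   uniformly in z because |Z_k| has no atom in ]0, +oo[: the event |Z_k| = z lies
   in the zero set of a quadratic polynomial in the noise that equals
   n beta_{k,0}^2 <> 0 at the origin. *)
Require Import Defs.
From HB Require Import structures.
From mathcomp Require Import all_boot all_order all_algebra.
From mathcomp Require Import all_classical all_reals all_analysis.
From mathcomp Require Import ring lra.
From mathcomp Require Import measurable_realfun normal_distribution.
Set Implicit Arguments. Unset Strict Implicit. Unset Printing Implicit Defensive.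
Import Order.TTheory GRing.Theory Num.Theory.
Import numFieldNormedType.Exports.
Local Open Scope classical_set_scope.
Local Open Scope ring_scope.

(** * Iterated integrals on the space of sequences *)

(** The true law is given only as an iterated integral of an indicator. It must first be turned into
    a probability measure, on the sigma-algebra generated by the coordinates, before continuity
    along monotone sequences of events is available. The law of [Zstat], a noncentral t, is never
    computed. The two facts needed about it, no atoms and positive tails, come from polynomials in
    the noise by recursion over the integrated coordinates: a nonzero polynomial in one variable has
    finitely many roots, and a positive value persists nearby. The order of the choices matters. One
    null coordinate fixes a gain [eps]; each non-null coordinate is then granted a loss of
    [eps / (K + 1)], so that at most [K] losses stay below [eps]. Both risks are sums of marginal
    probabilities and [gamma k] enters only the [k]-th term, so the coordinates are tuned separately
    although they share [sigma_hat]. *)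

Definition coord_cylinders (R : realType) : set (set (nat -> R)) :=
  [set A | exists i B, measurable B /\ A = (fun e : nat -> R => e i) @^-1` B].

(* [seqR R] is convertible to [nat -> R]; it only carries the product
   sigma-algebra of the coordinates. *)
Notation seqR R := (g_sigma_algebraType (@coord_cylinders R)).

Lemma measurable_coord (R : realType) (i : nat) :
  measurable_fun [set: seqR R] (fun e : seqR R => (e : nat -> R) i).
Proof.
by move=> _ B mB; rewrite setTI; apply: sub_sigma_algebra; exists i, B.
Qed.

Lemma measurable_fun_seqR (R : realType) (d : measure_display)
    (T : measurableType d) (f : T -> seqR R) :
  (forall i, measurable_fun setT (fun x => (f x : nat -> R) i)) ->
  measurable_fun setT f.
Proof.
move=> mf; apply: (@measurability _ _ T (seqR R) setT f (@coord_cylinders R) erefl).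
move=> _ [_ [i [B [mB ->]]] <-]; exact: mf.
Qed.

Lemma measurable_upd (R : realType) (j : nat) :
  measurable_fun [set: seqR R * R]
    (fun p : seqR R * R => upd (p.1 : nat -> R) j p.2 : seqR R).
Proof.
apply: measurable_fun_seqR => i; rewrite /upd; case: (i == j).
  exact: measurable_snd.
exact: (measurableT_comp (measurable_coord i) measurable_fst).
Qed.

Lemma measurable_upd2 (R : realType) (e : nat -> R) (j : nat) :
  measurable_fun [set: R] (fun t : R => upd e j t : seqR R).
Proof.
by apply: measurable_fun_seqR => i; rewrite /upd; case: (i == j).
Qed.

Lemma iter_int_ge0 (R : realType) (m : nat) (f : (nat -> R) -> \bar R) e :
  (forall x, 0 <= f x)%E -> (0 <= iter_int m f e)%E.
Proof.
by move=> f0; elim: m e => [|m IH] e //=; apply: integral_ge0.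
Qed.

(** [upd] is jointly measurable in the sequence and the new value, so each stage is a partial
    integral of a nonnegative jointly measurable function, as in Tonelli. *)
Lemma measurable_iter_int (R : realType) (m : nat) (f : seqR R -> \bar R) :
  measurable_fun [set: seqR R] f -> (forall x, 0 <= f x)%E ->
  measurable_fun [set: seqR R] (iter_int m f : seqR R -> \bar R).
Proof.
move=> mf f0; elim: m => [//|m IH] /=.
apply: (@measurable_fun_fubini_tonelli_F _ _ _ _ R (@lebesgue_measure R)
  (fun p : seqR R * R => iter_int m f (upd (p.1 : nat -> R) m p.2))).
  by apply: (measurableT_comp IH); exact: measurable_upd.
by move=> x; exact: iter_int_ge0.
Qed.

Lemma measurable_iter_int_upd (R : realType) (m : nat) (f : seqR R -> \bar R)
    (e : nat -> R) (j : nat) :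
  measurable_fun [set: seqR R] f -> (forall x, 0 <= f x)%E ->
  measurable_fun [set: R] (fun t => iter_int m f (upd e j t)).
Proof.
move=> mf f0; apply: (measurableT_comp (measurable_iter_int m mf f0)).
exact: measurable_upd2.
Qed.

Lemma iter_int_nneseries (R : realType) (m : nat)
    (f : nat -> seqR R -> \bar R) e :
  (forall k, measurable_fun [set: seqR R] (f k)) ->
  (forall k x, 0 <= f k x)%E ->
  iter_int m (fun x => \sum_(0 <= k <oo) f k x)%E e =
  (\sum_(0 <= k <oo) iter_int m (f k) e)%E.
Proof.
move=> mf f0; elim: m e => [//|m IH] e /=.
under eq_integral do rewrite IH.
rewrite integral_nneseries//.
- by move=> k; exact: measurable_iter_int_upd.
- by move=> k x _; exact: iter_int_ge0.
Qed.

Lemma iter_int_cst0 (R : realType) (m : nat) (e : nat -> R) :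
  iter_int m (fun=> 0%E) e = 0%E.
Proof.
by elim: m e => [//|m IH] e /=; under eq_integral do rewrite IH; rewrite integral0.
Qed.

(** Stopping after [m <= K] integrations makes the induction work: coordinates below [m] already
    contribute their integral, the others are still frozen at [e]. The case of all coordinates gives
    both the total mass of the noise and the posterior integrals. *)
Lemma iter_int_prod (R : realType) (K m : nat) (C : R) (h : 'I_K -> R -> R)
    (I : 'I_K -> R) (e : nat -> R) :
  (forall j, (@lebesgue_measure R).-integrable setT (EFin \o h j)) ->
  (forall j, \int[@lebesgue_measure R]_t (h j t)%:E = (I j)%:E)%E ->
  (m <= K)%N ->
  iter_int m (fun b => (C * \prod_(j < K) h j (b j))%:E) e =
  (C * \prod_(j < K) (if (j < m)%N then I j else h j (e j)))%:E.
Proof.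
move=> ih hI; elim: m e => [//|m IH] e mK /=.
pose j0 := Ordinal mK.
pose D := \prod_(j < K | j != j0) (if (j < m.+1)%N then I j else h j (e j)).
transitivity (\int[@lebesgue_measure R]_t ((C * D)%:E * (h j0 t)%:E))%E.
  apply: eq_integral => t _; rewrite IH ?(ltnW mK)//.
  rewrite (bigD1 j0)//= ltnn {1}/upd eqxx [h _ _ * _]mulrC mulrA EFinM.
  congr ((_ * _)%:E * _)%E; apply: eq_bigr => j jj0.
  have jm : (j : nat) != m by apply: contra jj0 => /eqP jm; apply/eqP/val_inj.
  by rewrite ltnS [(j <= m)%N]leq_eqVlt (negbTE jm) /upd (negbTE jm).
rewrite integralZl//; last exact: ih.
by rewrite hI -EFinM [in RHS](bigD1 j0)//= ltnSn -mulrA [D * _]mulrC.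
Qed.

(* Polynomiality in each coordinate separately is all that the recursion over
   the iterated integral uses. *)
Definition coordwise_poly (R : realType) (q : (nat -> R) -> R) :=
  forall e j, exists p : {poly R}, forall t, q (upd e j t) = p.[t].

Lemma upd_id (R : realType) (e : nat -> R) j : upd e j (e j) = e.
Proof. by apply/funext => i; rewrite /upd; case: eqP => [->|]. Qed.

Lemma finite_poly_roots (R : realType) (p : {poly R}) :
  p != 0 -> finite_set [set t | root p t].
Proof.
elim: (size p) {-2}p (leqnn (size p)) => [|s IH] {}p.
  by rewrite leqn0 size_poly_eq0 => ->.
move=> sp p0.
have [[x /factor_theorem[q pE]]|nr] := pselect (exists x, root p x); last first.
  rewrite (_ : [set t | root p t] = set0)//.
  by rewrite -subset0 => x /= rx; apply: nr; exists x.
have q0 : q != 0 by apply: contra p0 => /eqP q0; rewrite pE q0 mul0r.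
apply: (@sub_finite_set _ _ ([set t | root q t] `|` [set x])).
  move=> t /=; rewrite pE rootM root_XsubC => /orP[rq|/eqP ->]; last by right.
  by left.
rewrite finite_setU; split => //; apply: IH => //.
by move: sp; rewrite pE size_Mmonic ?monicXsubC// size_XsubC addn2 ltnS.
Qed.

(** Coordinates of [e] below [m] are integrated away, so they may be traded for those of a witness
    [e']. Along coordinate [m] the witness yields a nonzero polynomial; off its finitely many roots
    the updated witness feeds the induction. *)
Lemma iter_int_eq0 (R : realType) (m : nat) (f : seqR R -> \bar R)
    (q : (nat -> R) -> R) :
  measurable_fun [set: seqR R] f -> (forall x, 0 <= f x)%E ->
  coordwise_poly q -> (forall x, q x != 0 -> f x = 0%E) ->
  forall e e', (forall i, (m <= i)%N -> e i = e' i) -> q e' != 0 ->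
  iter_int m f e = 0%E.
Proof.
move=> mf f0 pq qf; elim: m => [|m IH] e e' ee' qe' /=.
  by apply: qf; rewrite (_ : e = e')//; apply/funext => i; apply: ee'.
have [p hp] := pq e' m.
have p0 : p != 0.
  by apply: contra qe' => /eqP p0; rewrite -(upd_id e' m) hp p0 horner0.
have fN := finite_poly_roots p0.
have cN := finite_set_countable fN.
rewrite (@ge0_negligible_integral _ _ _ (@lebesgue_measure R) setT [set t | root p t])//=.
- apply: integral0_eq => t [_ /= rt]; apply: (IH _ (upd e' m t)).
    move=> i mi; rewrite /upd; case: eqP => // /eqP im; apply: ee'.
    by rewrite ltn_neqAle eq_sym im.
  by rewrite hp; apply/negP => r0; apply: rt.
- exact: countable_measurable.
- exact: measurable_iter_int_upd.
- by move=> x _; apply: iter_int_ge0.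
- exact: countable_lebesgue_measure0.
Qed.

(** Same recursion on a witness, with openness along each coordinate: the witness stays in [A] over
    a ball, where the inner integral is positive, and a ball is not negligible. *)
Lemma iter_int_gt0 (R : realType) (m : nat) (f : seqR R -> \bar R)
    (A : set (nat -> R)) :
  measurable_fun [set: seqR R] f -> (forall x, 0 <= f x)%E ->
  (forall e j, A e -> \forall t \near e j, A (upd e j t)) ->
  (forall x, A x -> 0 < f x)%E ->
  forall e e', (forall i, (m <= i)%N -> e i = e' i) -> A e' ->
  (0 < iter_int m f e)%E.
Proof.
move=> mf f0 oA Af; elim: m => [|m IH] e e' ee' Ae' /=.
  by apply: Af; rewrite (_ : e = e')//; apply/funext => i; apply: ee'.
rewrite lt0e integral_ge0 ?andbT; last by move=> x _; apply: iter_int_ge0.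
apply/negP => /eqP I0.
have /nbhs_ballP[r /= r0 rA] := oA e' m Ae'.
have Fgt0 t : ball (e' m) r t -> (0 < iter_int m f (upd e m t))%E.
  move=> /rA At; apply: (IH _ (upd e' m t)) => //.
  move=> i mi; rewrite /upd; case: eqP => // /eqP im; apply: ee'.
  by rewrite ltn_neqAle eq_sym im.
have : (\int[@lebesgue_measure R]_t `|iter_int m f (upd e m t)| = 0)%E.
  by rewrite -[RHS]I0; apply: eq_integral => t _; rewrite gee0_abs// iter_int_ge0.
move=> /(ae_eq_integral_abs (@lebesgue_measure R) measurableT
  (measurable_iter_int_upd m e m mf f0)).1 [N [mN N0 sN]].
have : (lebesgue_measure (ball (e' m) r) <= lebesgue_measure N)%E.
  apply: le_measure; rewrite ?inE//; first exact: measurable_ball.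
  move=> t /Fgt0 Ft; apply: sN => /= /(_ I) Ft0.
  by rewrite Ft0 ltxx in Ft.
by rewrite N0 (lebesgue_measure_ball _ (ltW r0)) lee_fin leNgt pmulrn_lgt0 ?r0.
Qed.

(** * The law of the noise as a probability measure *)

Lemma measurable_noise_density (R : realType) (n : nat) (s : R) :
  measurable_fun [set: seqR R]
    (fun e : seqR R => \prod_(i < n) normal_pdf 0 s ((e : nat -> R) i)).
Proof.
apply: measurable_prod => i _.
exact: (measurableT_comp (measurable_normal_pdf 0 s) (measurable_coord i)).
Qed.

Lemma noise_density_ge0 (R : realType) (n : nat) (s : R) (e : nat -> R) :
  0 <= \prod_(i < n) normal_pdf 0 s (e i).
Proof. by apply: prodr_ge0 => i _; exact: normal_pdf_ge0. Qed.

Lemma measurable_noise_restr (R : realType) (n : nat) (s : R)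
    (A : set (seqR R)) : measurable A ->
  measurable_fun [set: seqR R]
    (fun e : seqR R => (\1_A e * \prod_(i < n) normal_pdf 0 s ((e : nat -> R) i))%:E).
Proof.
move=> mA; apply/measurable_EFinP/measurable_funM.
  exact: measurable_indic.
exact: measurable_noise_density.
Qed.

Lemma noise_restr_ge0 (R : realType) (n : nat) (s : R) (A : set (nat -> R))
    (e : nat -> R) :
  (0 <= (\1_A e * \prod_(i < n) normal_pdf 0 s (e i))%:E)%E.
Proof. by rewrite lee_fin mulr_ge0// noise_density_ge0. Qed.

(** Retyped over [seqR R] so that the measure structures can be attached to it. *)
Definition noise_measure (R : realType) (n : nat) (s : R)
  : set (seqR R) -> \bar R := noise_prob n s.

Lemma noise_measure0 (R : realType) (n : nat) (s : R) :
  noise_measure n s set0 = 0%E.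
Proof.
rewrite /noise_measure /noise_prob -[RHS](iter_int_cst0 n (fun=> 0 : R)).
by congr (iter_int n _ _); apply/funext => e; rewrite indic0 mul0r.
Qed.

Lemma noise_measure_ge0 (R : realType) (n : nat) (s : R) A :
  (0 <= noise_measure n s A)%E.
Proof. by apply: iter_int_ge0 => x; exact: noise_restr_ge0. Qed.

Lemma noise_measure_sigma_additive (R : realType) (n : nat) (s : R) :
  semi_sigma_additive (@noise_measure R n s).
Proof.
move=> F mF tF mUF; rewrite [X in _ --> X](_ : _ =
    (\sum_(0 <= k <oo) noise_measure n s (F k))%E).
  by apply: is_cvg_ereal_nneg_natsum => k _; exact: noise_measure_ge0.
rewrite /noise_measure /noise_prob -iter_int_nneseries.
- congr (iter_int n _ _); apply/funext => e.
  (* The indicator at [e] is the Dirac measure at [e]; its countable additivity splits the disjoint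
     union pointwise. *)
  have H := measure_semi_bigcup (@dirac _ (seqR R) e R) mF tF mUF.
  under eq_eseriesr do rewrite mulrC EFinM.
  rewrite nneseriesZl//.
  by rewrite mulrC EFinM; congr (_ * _)%E.
- by move=> k; exact: measurable_noise_restr.
- by move=> k e; exact: noise_restr_ge0.
Qed.

HB.instance Definition _ (R : realType) (n : nat) (s : R) :=
  isMeasure.Build _ _ _ (@noise_measure R n s) (noise_measure0 n s)
    (@noise_measure_ge0 R n s) (@noise_measure_sigma_additive R n s).

Lemma noise_measureT (R : realType) (n : nat) (s : R) :
  noise_measure n s setT = 1%E.
Proof.
rewrite /noise_measure /noise_prob (_ : (fun e => _) =
   (fun e : nat -> R => (1 * \prod_(i < n) normal_pdf 0 s (e i))%:E)); last first.
  by apply/funext => e; rewrite indicT.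
rewrite (@iter_int_prod R n n 1 (fun=> normal_pdf 0 s) (fun=> 1))//.
- by rewrite mul1r big1// => i _; rewrite ltn_ord.
- by move=> _; exact: integrable_normal_pdf.
- by move=> _; exact: integral_normal_pdf.
Qed.

HB.instance Definition _ (R : realType) (n : nat) (s : R) :=
  @Measure_isProbability.Build _ _ R (@noise_measure R n s)
    (noise_measureT n s).

Lemma noise_measure_poly_eq0 (R : realType) (n : nat) (s : R)
    (q : (nat -> R) -> R) (A : set (seqR R)) (e : nat -> R) :
  measurable A -> coordwise_poly q -> (forall x, A x -> q x = 0) ->
  (forall i, (n <= i)%N -> e i = 0) -> q e != 0 ->
  noise_measure n s A = 0%E.
Proof.
move=> mA pq Aq e0 qe; apply: (@iter_int_eq0 R n _ q _ _ pq _ _ e) => //.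
- exact: measurable_noise_restr.
- by move=> x; exact: noise_restr_ge0.
- move=> x qx; rewrite indicE memNset ?mul0r// => /Aq qx0.
  by rewrite qx0 eqxx in qx.
- by move=> i /e0.
Qed.

Lemma noise_measure_gt0 (R : realType) (n : nat) (s : R)
    (A : set (seqR R)) (e : nat -> R) :
  0 < s -> measurable A ->
  (forall e j, A e -> \forall t \near (e : nat -> R) j, A (upd e j t)) ->
  (forall i, (n <= i)%N -> e i = 0) -> A e ->
  (0 < noise_measure n s A)%E.
Proof.
move=> s0 mA oA e0 Ae; apply: (@iter_int_gt0 R n _ A _ _ oA _ _ e) => //.
- exact: measurable_noise_restr.
- by move=> x; exact: noise_restr_ge0.
- move=> x Ax; rewrite indicE mem_set// mul1r lte_fin prodr_gt0// => i _.
  rewrite normal_pdfE ?gt_eqF// mulr_gt0 ?expR_gt0// normal_peak_gt0//.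
  by rewrite gt_eqF.
- by move=> i /e0.
Qed.

(** * Gaussian moments and the posterior mean *)

Lemma measurable_reflect (R : realType) (c : R) :
  measurable_fun [set: R] (fun t : R => c - t).
Proof. exact: measurable_funB. Qed.

(** Lebesgue measure is determined by its values on half-open intervals, and reflection preserves
    their length while exchanging the open and closed ends. *)
Lemma lebesgue_measure_reflect (R : realType) (c : R) (A : set R) :
  measurable A ->
  pushforward (@lebesgue_measure R)
    (fun t : measurableTypeR R => (c - t : measurableTypeR R)) A =
  lebesgue_measure A.
Proof.
move=> mA; apply/esym/lebesgue_measure_unique => //=.
  exact: measurable_reflect.
move=> mc _ [[a b]] _ <-; rewrite /pushforward.
have -> : (fun t => c - t) @^-1` `]a, b]%classic = `[c - b, c - a[%classic :> set R.
  by apply/seteqP; split => t /=; rewrite !in_itv/= => /andP[? ?];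
    apply/andP; split; lra.
rewrite !lebesgue_measure_itv/= !lte_fin ltrD2l ltrN2.
by case: ifP => // _; rewrite -!EFinD; congr EFin; ring.
Qed.

Lemma integral_reflect (R : realType) (c : R) (f : R -> \bar R) :
  measurable_fun [set: R] f ->
  (@lebesgue_measure R).-integrable setT (fun t => f (c - t)) ->
  (\int[@lebesgue_measure R]_t f t = \int[@lebesgue_measure R]_t f (c - t)%R)%E.
Proof.
move=> mf intf.
have mc : measurable_fun [set: measurableTypeR R]
    (fun t : measurableTypeR R => (c - t : measurableTypeR R)).
  exact: measurable_reflect.
have := @integral_pushforward _ _ _ _ R _ mc (@lebesgue_measure R) setT f mf intf measurableT.
rewrite preimage_setT => <-; apply: eq_measure_integral => A mA _.
by apply/esym; exact: lebesgue_measure_reflect.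
Qed.

(* [|u| <= s e^(u^2 / 4s^2)] trades the factor [|u|] for a wider Gaussian. *)
Lemma integrable_centered_normal_pdf (R : realType) (m s : R) : 0 < s ->
  (@lebesgue_measure R).-integrable setT
    (fun t => ((t - m) * normal_pdf m s t)%:E).
Proof.
(* Doubling the variance halves the Gaussian exponent: one half stays as the dominating density, the
   other absorbs the linear factor. *)
move=> s0; pose s2 := Num.sqrt 2 * s.
have s20 : 0 < s2 by rewrite mulr_gt0// sqrtr_gt0.
have s2E : s2 ^+ 2 = 2 * s ^+ 2 by rewrite exprMn sqr_sqrtr.
have p0 := normal_peak_gt0 (lt0r_neq0 s0).
have p20 := normal_peak_gt0 (lt0r_neq0 s20).
have [c c0 cE] : exists2 c, 0 <= c & c * normal_peak s2 = s * normal_peak s.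
  exists (s * normal_peak s / normal_peak s2); last by rewrite divfK ?gt_eqF.
  by rewrite divr_ge0 ?mulr_ge0// ltW.
apply: (@le_integrable _ _ R (@lebesgue_measure R) setT measurableT _
  (fun t => (c * normal_pdf m s2 t)%:E)).
- apply/measurable_EFinP; apply: measurable_funM.
    exact: measurable_funB.
  exact: measurable_normal_pdf.
- move=> t _; rewrite lee_fin !normrM.
  rewrite [`|normal_pdf m s t|]ger0_norm ?normal_pdf_ge0//.
  rewrite [`|normal_pdf m s2 t|]ger0_norm ?normal_pdf_ge0//.
  rewrite !normal_pdfE ?gt_eqF// (ger0_norm c0) [leRHS]mulrA cE.
  rewrite mulrCA [s * _]mulrC -mulrA ler_pM2l//.
  rewrite /normal_fun s2E.
  have -> : expR (- (t - m) ^+ 2 / (2 * s ^+ 2 *+ 2)) =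
    expR ((t - m) ^+ 2 / (2 * s ^+ 2 *+ 2)) *
    expR (- (t - m) ^+ 2 / (s ^+ 2 *+ 2)).
    rewrite -expRD; congr expR; rewrite !mulr2n; field.
    have ss0 : 0 < s ^+ 2 by rewrite exprn_gt0.
    by apply/andP; split; apply: lt0r_neq0; lra.
  rewrite mulrA ler_pM2r ?expR_gt0//.
  apply: (@le_trans _ _ (s * (1 + (t - m) ^+ 2 / (2 * s ^+ 2 *+ 2)))); last first.
    by rewrite ler_pM2l// expR_ge1Dx.
  rewrite -(real_normK (num_real (t - m))); set u := `|t - m|.
  rewrite -subr_ge0 -mulr_natr.
  have -> : s * (1 + u ^+ 2 / (2 * s ^+ 2 * 2)) - u = (2 * s - u) ^+ 2 / (4 * s).
    by field; rewrite gt_eqF.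
  by rewrite divr_ge0 ?sqr_ge0// mulr_ge0// ltW.
- under eq_fun do rewrite EFinM.
  by apply: integrableZl => //; exact: integrable_normal_pdf.
Qed.

Lemma integrable_idM_normal_pdf (R : realType) (m s : R) : 0 < s ->
  (@lebesgue_measure R).-integrable setT (fun t => (t * normal_pdf m s t)%:E).
Proof.
move=> s0.
rewrite (_ : (fun t => _) = (fun t => ((t - m) * normal_pdf m s t)%:E) \+
   (fun t => (m%:E * (normal_pdf m s t)%:E)))%E; last first.
  by apply/funext => t /=; rewrite -EFinM -EFinD; congr EFin; ring.
apply: integrableD => //; first exact: integrable_centered_normal_pdf.
by apply: integrableZl => //; exact: integrable_normal_pdf.
Qed.

(** Under the reflection of [t] about [m] the centred integrand changes sign, so its integral, being
    finite and equal to its opposite, is zero; [m] times a unit mass remains. *)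
Lemma integral_idM_normal_pdf (R : realType) (m s : R) : 0 < s ->
  (\int[@lebesgue_measure R]_t (t * normal_pdf m s t)%:E = m%:E)%E.
Proof.
move=> s0; have ih := integrable_centered_normal_pdf m s0.
have hN t : (m + m - t - m) * normal_pdf m s (m + m - t) =
            - ((t - m) * normal_pdf m s t).
  rewrite !normal_pdfE ?gt_eqF// /normal_fun.
  have -> : m + m - t - m = - (t - m) by ring.
  by rewrite sqrrN mulNr.
have h0 : (\int[@lebesgue_measure R]_t ((t - m) * normal_pdf m s t)%:E = 0)%E.
  have := @integral_reflect R (m + m) (fun t => ((t - m) * normal_pdf m s t)%:E).
  under [in X in (_ -> _ -> _ = X)%E -> _]eq_integral do rewrite hN EFinN.
  rewrite integralN => [H|].
  have {}H := H (measurable_int _ ih).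
  have : (@lebesgue_measure R).-integrable setT
      (fun t => ((m + m - t - m) * normal_pdf m s (m + m - t))%:E).
    rewrite (_ : (fun t => _) = \- (fun t => ((t - m) * normal_pdf m s t)%:E))%E.
      exact: integrableN.
    by apply/funext => t /=; rewrite hN.
  move=> /H; have /fineK <- := integrable_fin_num measurableT ih.
  by rewrite -EFinN => -[] E; congr EFin; lra.
  exact: integrable_add_def.
transitivity (\int[@lebesgue_measure R]_t (((t - m) * normal_pdf m s t)%:E +
   m%:E * (normal_pdf m s t)%:E))%E.
  by apply: eq_integral => t _; rewrite -EFinM -EFinD; congr EFin; ring.
rewrite integralD//; last first.
  by apply: integrableZl => //; exact: integrable_normal_pdf.
rewrite h0 add0e integralZl//; last exact: integrable_normal_pdf.
by rewrite integral_normal_pdf mule1.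
Qed.

(** The orthogonal design leaves no cross terms between coordinates of [b], which is why the
    posterior factorises. *)
Lemma sum_sqr_residual (R : realType) (n K : nat) (X : 'M[R]_(n, K))
    (y : 'cV[R]_n) (b : 'cV[R]_K) : X^T *m X = n%:R%:M ->
  \sum_i (y i 0 - (X *m b) i 0) ^+ 2 =
  \sum_i (y i 0) ^+ 2 - 2 * \sum_k (b k 0 * (X^T *m y) k 0)
  + n%:R * \sum_k (b k 0) ^+ 2.
Proof.
move=> XX.
have sqrE (p : nat) (v : 'cV[R]_p) : \sum_i v i 0 ^+ 2 = (v^T *m v) 0 0.
  by rewrite mxE; apply: eq_bigr => i _; rewrite mxE expr2.
have -> : \sum_k (b k 0 * (X^T *m y) k 0) = (b^T *m (X^T *m y)) 0 0.
  by rewrite [RHS]mxE; apply: eq_bigr => i _; rewrite [b^T _ _]mxE.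
rewrite !sqrE; transitivity (((y - X *m b)^T *m (y - X *m b)) 0 0).
  by rewrite -sqrE; apply: eq_bigr => i _; rewrite !mxE.
have yXb : y^T *m (X *m b) = b^T *m (X^T *m y).
  transitivity (y^T *m (X *m b))^T.
    by apply/matrixP => i j; rewrite [RHS]mxE !ord1.
  by rewrite !trmx_mul trmxK mulmxA.
have bb : (X *m b)^T *m (X *m b) = n%:R *: (b^T *m b).
  by rewrite trmx_mul -mulmxA (mulmxA X^T) XX mul_scalar_mx scalemxAr.
rewrite [(y - X *m b)^T]linearB/= mulmxBl !mulmxBr yXb bb trmx_mul -mulmxA !mxE; ring.
Qed.

Lemma prod_normal_pdf (R : realType) (n : nat) (m s t : 'I_n -> R) :
  (forall i, s i != 0) ->
  \prod_(i < n) normal_pdf (m i) (s i) (t i) =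
  \prod_(i < n) normal_peak (s i) *
  expR (\sum_(i < n) - (t i - m i) ^+ 2 / (s i ^+ 2 *+ 2)).
Proof.
move=> s0; rewrite expR_sum -big_split/=; apply: eq_bigr => i _.
by rewrite normal_pdfE.
Qed.

(** Complete the square in each coordinate: as [1 / d = 1 + 1 / gamma], the exponent
    [b w - b^2 / 2 - b^2 / (2 gamma)] equals [d w^2 / 2 - (b - d w)^2 / (2 d)]. [C] gathers
    everything free of [b] and will cancel in the posterior mean. *)
Lemma joint_densE (R : realType) (n K : nat) (X : 'M[R]_(n, K))
    (gamma : 'I_K -> R) (y : 'cV[R]_n) : (0 < n)%N ->
  X^T *m X = n%:R%:M -> (forall k, 0 < gamma k) ->
  exists2 C : R, C != 0 & forall b, joint_dens X gamma y b =
    C * \prod_(k < K) normal_pdf (gamma k / (1 + gamma k) *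
                                  ((X^T *m y) k 0 / n%:R))
                        (Num.sqrt (gamma k / (1 + gamma k))) (b k).
Proof.
move=> n0 XX g0.
have nR0 : 0 < n%:R :> R by rewrite ltr0n.
pose d k := gamma k / (1 + gamma k).
pose w k := (X^T *m y) k 0 / n%:R.
have d0 k : 0 < d k by rewrite divr_gt0// addr_gt0.
have sn0 : Num.sqrt (1 * n%:R) != 0 :> R by rewrite mul1r gt_eqF// sqrtr_gt0.
have sg0 k : Num.sqrt (gamma k) != 0 by rewrite gt_eqF// sqrtr_gt0.
have sd0 k : Num.sqrt (d k) != 0 by rewrite gt_eqF// sqrtr_gt0.
pose A := \prod_(i < n) normal_peak (Num.sqrt (1 * n%:R) : R).
pose B := \prod_(k < K) normal_peak (Num.sqrt (gamma k)).
pose D := \prod_(k < K) normal_peak (Num.sqrt (d k)).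
pose E := - (\sum_i (y i 0) ^+ 2) / (n%:R * 2) + \sum_k (d k * w k ^+ 2 / 2).
have A0 : A != 0 by apply/prodf_neq0 => i _; rewrite gt_eqF// normal_peak_gt0.
have B0 : B != 0 by apply/prodf_neq0 => i _; rewrite gt_eqF// normal_peak_gt0.
have D0 : D != 0 by apply/prodf_neq0 => i _; rewrite gt_eqF// normal_peak_gt0.
exists (A * B * expR E / D) => [|b].
  by rewrite !mulf_neq0 ?invr_eq0// gt_eqF// expR_gt0.
rewrite /joint_dens -/(d _).
rewrite !prod_normal_pdf// -/A -/B -/D.
rewrite [RHS]mulrA divfK// mulrACA -expRD -[RHS]mulrA -expRD; congr (_ * expR _).
have -> : \sum_(i < n) - (y i 0 - (X *m \col_j b j) i 0) ^+ 2 /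
      (Num.sqrt (1 * n%:R) ^+ 2 *+ 2) = - (\sum_i (y i 0) ^+ 2) / (n%:R * 2)
      + \sum_(k < K) (b k * w k - b k ^+ 2 / 2).
  rewrite sqr_sqrtr ?mul1r ?ler0n// -mulr_suml sumrN -mulr_natr.
  rewrite (sum_sqr_residual y (\col_j b j) XX).
  rewrite sumrB -mulr_suml.
  have -> : \sum_k (\col_(j < K) b j) k 0 ^+ 2 = \sum_(k < K) b k ^+ 2.
    by apply: eq_bigr => k _; rewrite mxE.
  have -> : \sum_k ((\col_(j < K) b j) k 0 * (X^T *m y) k 0) =
      n%:R * \sum_(k < K) (b k * w k).
    rewrite mulr_sumr; apply: eq_bigr => k _; rewrite mxE /w.
    by field; rewrite gt_eqF.
  by field; rewrite gt_eqF.
rewrite /E -[LHS]addrA -[RHS]addrA; congr (_ + _).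
rewrite -!big_split/=; apply: eq_bigr => k _.
rewrite -/(d k) -/(w k) !sqr_sqrtr ?(ltW (d0 k)) ?(ltW (g0 k))//.
have g1 : 0 < 1 + gamma k by rewrite addr_gt0.
rewrite !mulr2n /d; field.
by rewrite !gt_eqF// ?divr_gt0// ?addr_gt0// ?divr_gt0.
Qed.

Lemma post_meanE (R : realType) (n K : nat) (X : 'M[R]_(n, K))
    (gamma : 'I_K -> R) (y : 'cV[R]_n) (k : 'I_K) : (0 < n)%N ->
  X^T *m X = n%:R%:M -> (forall k, 0 < gamma k) ->
  post_mean X gamma y k = gamma k / (1 + gamma k) * ((X^T *m y) k 0 / n%:R).
Proof.
move=> n0 XX g0; have [C C0 dE] := joint_densE y n0 XX g0.
set mu := fun k => gamma k / (1 + gamma k) * ((X^T *m y) k 0 / n%:R) in dE *.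
set s := fun k => Num.sqrt (gamma k / (1 + gamma k)) in dE *.
have s0 j : 0 < s j by rewrite sqrtr_gt0 divr_gt0// addr_gt0.
(* Absorbing the factor [b k] into the [k]-th term keeps the numerator a product, so one formula
   evaluates numerator and denominator. *)
pose h j t := (if j == k then t else 1) * normal_pdf (mu j) (s j) t.
rewrite /post_mean.
have -> : (fun b : nat -> R => (joint_dens X gamma y b)%:E) =
    (fun b => (C * \prod_(j < K) normal_pdf (mu j) (s j) (b j))%:E).
  by apply/funext => b; rewrite dE.
rewrite (@iter_int_prod R K K C (fun j => normal_pdf (mu j) (s j)) (fun=> 1))//;
  last 2 first.
- by move=> j; exact: integrable_normal_pdf.
- by move=> j; exact: integral_normal_pdf.
have -> : (fun b : nat -> R => (b k * joint_dens X gamma y b)%:E) =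
    (fun b => (C * \prod_(j < K) h j (b j))%:E).
  apply/funext => b; rewrite dE big_split/= -big_mkcond/= big_pred1_eq.
  by rewrite mulrCA.
rewrite (@iter_int_prod R K K C h (fun j => if j == k then mu j else 1))//; last 2 first.
- move=> j; rewrite /h; case: eqP => _; first exact: integrable_idM_normal_pdf.
  rewrite (_ : _ \o _ = (fun t => (normal_pdf (mu j) (s j) t)%:E)).
    exact: integrable_normal_pdf.
  by apply/funext => t /=; rewrite mul1r.
- move=> j; rewrite /h; case: eqP => _; first exact: integral_idM_normal_pdf.
  by under eq_integral do rewrite mul1r; exact: integral_normal_pdf.
rewrite /= [X in _ / (_ * X)]big1 => [|i _]; last by rewrite ltn_ord.
under eq_bigr do rewrite ltn_ord.
by rewrite -big_mkcond/= big_pred1_eq mulr1 mulrC mulKf.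
Qed.

(** * The statistics under the orthogonal design *)

Lemma olsE (R : realType) (n K : nat) (X : 'M[R]_(n, K)) (Y : 'cV[R]_n) :
  (0 < n)%N -> X^T *m X = n%:R%:M -> ols X Y = n%:R^-1 *: (X^T *m Y).
Proof.
by move=> n0 XX; rewrite /ols XX invmx_scalar mul_scalar_mx -scalemxAl.
Qed.

Lemma s_diagE (R : realType) (n K : nat) (X : 'M[R]_(n, K)) k :
  (0 < n)%N -> X^T *m X = n%:R%:M -> s_diag X k = 1.
Proof.
move=> n0 XX; rewrite /s_diag XX scale_scalar_mx mulVf ?pnatr_eq0 -?lt0n//.
by rewrite invmx1 mxE eqxx.
Qed.

Lemma ZstatE (R : realType) (n K : nat) (X : 'M[R]_(n, K)) Y k :
  (0 < n)%N -> X^T *m X = n%:R%:M ->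
  Zstat X Y k = Num.sqrt n%:R * ols X Y k 0 / sigma_hat X Y.
Proof. by move=> n0 XX; rewrite /Zstat s_diagE// sqrtr1 mulr1. Qed.

(** The posterior mean is linear in the data, so the rescaling factor comes out and turns the OLS
    coordinate into [Zstat]. Both sides carry the same total inverse of [sigma_hat], so the identity
    covers [sigma_hat = 0]. *)
Lemma beta_starE (R : realType) (n K : nat) (X : 'M[R]_(n, K))
    (beta0 : 'cV[R]_K) (gamma : 'I_K -> R) (e : nat -> R) (k : 'I_K) :
  (0 < n)%N -> X^T *m X = n%:R%:M -> (forall k, 0 < gamma k) ->
  beta_star X beta0 gamma e k =
  gamma k / (1 + gamma k) * Zstat X (resp X beta0 e) k.
Proof.
move=> n0 XX g0; rewrite /beta_star post_meanE// ZstatE//; congr (_ * _).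
rewrite olsE// /rescaled -scalemxAr !mxE; ring.
Qed.

(** * Normal quantiles *)

Lemma std_normal_cdf_nondecreasing (R : realType) (x y : R) : x <= y ->
  std_normal_cdf x <= std_normal_cdf y.
Proof.
move=> xy; apply: fine_le; rewrite ?fin_num_measure//.
by apply: le_measure; rewrite ?inE//; exact: subset_itvl.
Qed.

Lemma std_normal_cdf0 (R : realType) : std_normal_cdf (0 : R) = 1 / 2.
Proof.
have mN : measurable_fun [set: R] (fun t => (normal_pdf (0 : R) 1 t)%:E).
  by apply/measurable_EFinP; exact: measurable_normal_pdf.
have sym : normal_prob (0 : R) 1 `]0, +oo[ = normal_prob 0 1 `]-oo, 0].
  rewrite /normal_prob integral_itv_obnd_cbnd; last exact: measurable_funTS.
  rewrite ge0_integration_by_substitution0//.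
  - apply: eq_integral => t _.
    by rewrite !normal_pdfE ?oner_eq0// /normal_fun !subr0 sqrrN.
  - by move=> t; rewrite lee_fin normal_pdf_ge0.
have : (normal_prob 0%R 1%R `]-oo, 0%R : R] + normal_prob 0%R 1%R `]0%R : R, +oo[ = 1)%E.
  rewrite -measureU//.
    rewrite -(@probability_setT _ _ R (normal_prob (0 : R) 1)); congr normal_prob.
    by rewrite -setCitvl setUv.
  by rewrite -setCitvl setICr.
rewrite sym /std_normal_cdf.
have /fineK <- : normal_prob (0 : R) 1 `]-oo, 0] \is a fin_num.
  exact: fin_num_measure.
by rewrite -EFinD => -[] /=; lra.
Qed.

(** The density never exceeds its peak. This bound keeps quantiles of levels above [1 / 2] away from
    0. *)
Lemma std_normal_cdf_le (R : realType) (x : R) : 0 <= x ->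
  std_normal_cdf x <= 1 / 2 + normal_peak 1 * x.
Proof.
move=> x0; have p0 := normal_peak_ge0 (1 : R).
rewrite -std_normal_cdf0 -lee_fin EFinD /std_normal_cdf !fineK ?fin_num_measure//.
have -> : `]-oo, x]%classic = `]-oo, 0]%classic `|` `]0, x]%classic.
  by rewrite -itv_bndbnd_setU.
apply: (@le_trans _ _ (normal_prob 0 1 `]-oo, 0%R : R] + normal_prob 0 1 `]0%R : R, x])%E).
  exact: measureU2.
apply: leeD2l.
have -> : (normal_peak 1 * x)%:E =
    (\int[@lebesgue_measure R]_(t in `]0%R, x]) (normal_peak (1%R : R))%:E)%E.
  rewrite integral_cst//= lebesgue_measure_itv/= lte_fin.
  case: ifPn => [_|]; first by rewrite -EFinD subr0 -EFinM.
  by rewrite -leNgt => x0'; rewrite (le_anti (introT andP (conj x0' x0))) mulr0 mule0.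
apply: ge0_le_integral => //.
- by move=> t _; rewrite lee_fin normal_pdf_ge0.
- by apply/measurable_EFinP/measurable_funTS; exact: measurable_normal_pdf.
- by move=> t _; rewrite lee_fin normal_pdf_ub ?oner_eq0.
Qed.

Lemma std_normal_cdf_ge (R : realType) (eps : R) : 0 < eps ->
  exists b, 1 - eps <= std_normal_cdf b.
Proof.
move=> e0.
have : (normal_prob (0 : R) 1 \o (fun m : nat => `]-oo, m%:R]%classic)) @ \oo
    --> normal_prob 0 1 (\bigcup_(m : nat) `]-oo, m%:R]%classic).
  apply: nondecreasing_cvg_mu => //; first exact: bigcup_measurable.
  by move=> m m' mm'; apply/subsetPset; apply: subset_itvl; rewrite bnd_simp ler_nat.
rewrite (_ : \bigcup_m _ = setT); last first.
  apply/seteqP; split => // t _; exists (Num.truncn `|t|).+1 => //=.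
  by rewrite in_itv/= (le_trans (ler_norm _))// ltW// truncnS_gt.
rewrite probability_setT => /fine_cvgP[_ /cvgrPdist_le/(_ _ e0)[m _ /(_ m (leqnn m))]] /=.
rewrite ler_norml => /andP[_ H]; exists m%:R; rewrite /std_normal_cdf; lra.
Qed.

Lemma z_half_bounds (R : realType) (delta : R) : 0 < delta ->
  exists a b, 0 < a /\
    forall alpha, delta <= alpha <= 1 - delta -> a <= z_half alpha <= b.
Proof.
move=> d0; have p0 := normal_peak_gt0 (oner_neq0 R).
have [b hb] : exists b : R, 1 - delta / 2 <= std_normal_cdf b.
  by apply: std_normal_cdf_ge; lra.
(* Makes the linear bound equal [1 / 2 + delta / 4], strictly below every level
   [1 - alpha / 2 >= 1 / 2 + delta / 2]; so [a] is a lower bound of the set whose infimum is the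
   quantile. *)
pose a := delta / (4 * normal_peak 1).
have a0 : 0 < a by rewrite divr_gt0// mulr_gt0.
have ha : std_normal_cdf a <= 1 / 2 + delta / 4.
  apply: le_trans (std_normal_cdf_le (ltW a0)) _; rewrite lerD2l /a.
  by rewrite le_eqVlt; apply/orP; left; apply/eqP; field; rewrite gt_eqF.
exists a, b; split => // alpha /andP[da ad].
have lbS : lbound [set z : R | 1 - alpha / 2 <= std_normal_cdf z] a.
  move=> z /= hz; rewrite leNgt; apply/negP => /ltW/std_normal_cdf_nondecreasing.
  lra.
have bS : [set z : R | 1 - alpha / 2 <= std_normal_cdf z] b by rewrite /=; lra.
apply/andP; split.
  by apply: lb_le_inf => //; exists b.
by apply: ge_inf => //; exists a.
Qed.

(** * Distribution of the Z statistics *)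

Lemma measurable_ge_set (R : realType) (d : measure_display)
    (T : measurableType d) (W : T -> R) (z : R) :
  measurable_fun setT W -> measurable [set x | z <= W x].
Proof.
move=> mW; rewrite -[X in measurable X]setTI.
rewrite (_ : [set x | _] = W @^-1` `[z, +oo[); first exact: mW.
by apply/seteqP; split => x /=; rewrite in_itv/= andbT.
Qed.

Lemma measurable_lt_set (R : realType) (d : measure_display)
    (T : measurableType d) (W : T -> R) (z : R) :
  measurable_fun setT W -> measurable [set x | W x < z].
Proof.
move=> mW; rewrite (_ : [set x | _] = ~` [set x | z <= W x]).
  by apply: measurableC; exact: measurable_ge_set.
by apply/seteqP; split => x /=; rewrite ltNge => /negP.
Qed.

(** * Functions polynomial in each noise coordinate *)

Definition coord_regular (R : realType) (q : seqR R -> R) :=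
  coordwise_poly q /\ measurable_fun [set: seqR R] q.

Lemma coord_regular_cst (R : realType) (c : R) :
  coord_regular (fun=> c).
Proof.
split; last exact: measurable_cst.
by move=> e j; exists c%:P => t; rewrite hornerC.
Qed.

Lemma coord_regular_coord (R : realType) i :
  coord_regular (fun e : nat -> R => e i).
Proof.
split; last exact: measurable_coord.
move=> e j; rewrite /upd; case: (i == j); first by exists 'X => t; rewrite hornerX.
by exists (e i)%:P => t; rewrite hornerC.
Qed.

Lemma coord_regularD (R : realType) (f g : (nat -> R) -> R) :
  coord_regular f -> coord_regular g -> coord_regular (fun e => f e + g e).
Proof.
move=> [pf mf] [pg mg]; split; last exact: measurable_funD.
move=> e j; have [p fp] := pf e j; have [q gq] := pg e j.
by exists (p + q) => t; rewrite hornerD fp gq.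
Qed.

Lemma coord_regularM (R : realType) (f g : (nat -> R) -> R) :
  coord_regular f -> coord_regular g -> coord_regular (fun e => f e * g e).
Proof.
move=> [pf mf] [pg mg]; split; last exact: measurable_funM.
move=> e j; have [p fp] := pf e j; have [q gq] := pg e j.
by exists (p * q) => t; rewrite hornerM fp gq.
Qed.

Lemma coord_regularN (R : realType) (f : (nat -> R) -> R) :
  coord_regular f -> coord_regular (fun e => - f e).
Proof.
move=> rf; under eq_fun do rewrite -mulN1r.
by apply: coord_regularM => //; exact: coord_regular_cst.
Qed.

Lemma coord_regular_sum (R : realType) (I : finType) (f : I -> (nat -> R) -> R) :
  (forall i, coord_regular (f i)) -> coord_regular (fun e => \sum_i f i e).
Proof.
move=> rf; elim: (index_enum I) => [|i r IH].
  by under eq_fun do rewrite big_nil; exact: coord_regular_cst.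
by under eq_fun do rewrite big_cons; exact: coord_regularD.
Qed.

Lemma coord_regular_gt0_near (R : realType) (q : (nat -> R) -> R) e j :
  coord_regular q -> 0 < q e -> \forall t \near e j, 0 < q (upd e j t).
Proof.
move=> [pq _] qe; have [p qp] := pq e j.
have pe : 0 < p.[e j] by rewrite -qp upd_id.
have H : \forall t \near e j, 0 < p.[t].
  exact: (cvgr_gt p.[e j] (@continuous_horner R p (e j))).
by apply: filterS H => t; rewrite qp.
Qed.

(** Residual sum of squares: unlike [sigma_hat], it involves no root and so is polynomial in the
    noise. *)
Definition rss (R : realType) n K (X : 'M[R]_(n, K)) (Y : 'cV[R]_n) : R :=
  \sum_(i < n) ((Y - X *m ols X Y) i 0) ^+ 2.

Lemma rss_ge0 (R : realType) n K (X : 'M[R]_(n, K)) Y : 0 <= rss X Y.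
Proof. by apply: sumr_ge0 => i _; exact: sqr_ge0. Qed.

Lemma sigma_hat_ge0 (R : realType) n K (X : 'M[R]_(n, K)) Y :
  0 <= sigma_hat X Y.
Proof. exact: sqrtr_ge0. Qed.

Lemma sqr_sigma_hat (R : realType) n K (X : 'M[R]_(n, K)) Y :
  sigma_hat X Y ^+ 2 = rss X Y / (n - K)%:R.
Proof. by rewrite sqr_sqrtr// divr_ge0// ?rss_ge0// ler0n. Qed.

Lemma coord_regular_mulmx (R : realType) n K (A : 'M[R]_(K, n))
    (Y : (nat -> R) -> 'cV[R]_n) k :
  (forall i, coord_regular (fun e => Y e i 0)) ->
  coord_regular (fun e => (A *m Y e) k 0).
Proof.
move=> rY; under eq_fun do rewrite mxE.
by apply: coord_regular_sum => i; apply: coord_regularM => //;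
  exact: coord_regular_cst.
Qed.

Lemma coord_regular_resp (R : realType) n K (X : 'M[R]_(n, K)) beta0 i :
  coord_regular (fun e => resp X beta0 e i 0).
Proof.
under eq_fun do rewrite mxE.
by apply: coord_regularD; [exact: coord_regular_cst|exact: coord_regular_coord].
Qed.

Lemma coord_regular_ols (R : realType) n K (X : 'M[R]_(n, K)) beta0 k :
  coord_regular (fun e => ols X (resp X beta0 e) k 0).
Proof. by apply: coord_regular_mulmx => i; exact: coord_regular_resp. Qed.

Lemma coord_regular_rss (R : realType) n K (X : 'M[R]_(n, K)) beta0 :
  coord_regular (fun e => rss X (resp X beta0 e)).
Proof.
have rr i : coord_regular (fun e =>
    (resp X beta0 e - X *m ols X (resp X beta0 e)) i 0).
  under eq_fun do rewrite mxE [(- (X *m _)) _ _]mxE.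
  apply: coord_regularD; first exact: coord_regular_resp.
  by apply/coord_regularN/coord_regular_mulmx => k; exact: coord_regular_ols.
rewrite /rss; apply: coord_regular_sum => i.
by under eq_fun do rewrite expr2; exact: coord_regularM.
Qed.

(* [sigma_hat] is nonnegative, so its total inverse is the power [-1]. *)
Lemma measurable_Zstat (R : realType) n K (X : 'M[R]_(n, K)) beta0 k :
  (0 < n)%N -> X^T *m X = n%:R%:M ->
  measurable_fun [set: seqR R] (fun e : seqR R => Zstat X (resp X beta0 e) k).
Proof.
move=> n0 XX; rewrite (_ : (fun e => Zstat _ _ _) = (fun e : nat -> R =>
    Num.sqrt n%:R * ols X (resp X beta0 e) k 0 *
    sigma_hat X (resp X beta0 e) `^ (-1))); last first.
  by apply/funext => e; rewrite ZstatE// powR_inv1// sigma_hat_ge0.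
apply: measurable_funM.
  apply: measurable_funM; first exact: measurable_cst.
  exact: (coord_regular_ols X beta0 k).2.
apply: (measurableT_comp (measurable_powR _)).
apply: (@measurableT_comp _ _ _ _ _ _ (@Num.sqrt R)).
  by apply: continuous_measurable_fun; exact: sqrt_continuous.
apply: measurable_funM; last exact: measurable_cst.
exact: (coord_regular_rss X beta0).2.
Qed.

Lemma measurable_norm_Zstat (R : realType) n K (X : 'M[R]_(n, K)) beta0 k :
  (0 < n)%N -> X^T *m X = n%:R%:M ->
  measurable_fun [set: seqR R] (fun e : seqR R => `|Zstat X (resp X beta0 e) k|).
Proof.
move=> n0 XX; exact: (measurableT_comp (@normr_measurable R setT)
  (measurable_Zstat beta0 k n0 XX)).
Qed.

(* When [sigma_hat] is nonzero, [|Z_k|] and [z] compare as [contrast] and [0];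
   when it vanishes, division by zero makes [Z_k = 0]. *)
Definition contrast (R : realType) n K (X : 'M[R]_(n, K)) beta0 k (z : R)
    (e : nat -> R) : R :=
  n%:R * ols X (resp X beta0 e) k 0 ^+ 2
  - z ^+ 2 / (n - K)%:R * rss X (resp X beta0 e).

Lemma coord_regular_contrast (R : realType) n K (X : 'M[R]_(n, K)) beta0 k z :
  coord_regular (contrast X beta0 k z).
Proof.
have rcM c (f : (nat -> R) -> R) : coord_regular f -> coord_regular (fun e => c * f e).
  by move=> rf; apply: coord_regularM => //; exact: coord_regular_cst.
rewrite /contrast; apply: coord_regularD.
  apply: rcM; under eq_fun do rewrite expr2.
  by apply: coord_regularM; exact: coord_regular_ols.
by apply/coord_regularN/rcM; exact: coord_regular_rss.
Qed.

Lemma Zstat_eq_contrast0 (R : realType) n K (X : 'M[R]_(n, K)) beta0 k z e :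
  (0 < n)%N -> X^T *m X = n%:R%:M -> 0 < z ->
  `|Zstat X (resp X beta0 e) k| = z -> contrast X beta0 k z e = 0.
Proof.
move=> n0 XX z0; rewrite ZstatE// /contrast; set Y := resp _ _ _ => Zz.
have s0 : sigma_hat X Y != 0.
  apply/eqP => s0; move: Zz; rewrite s0 invr0 mulr0 normr0 => z00.
  by rewrite -z00 ltxx in z0.
rewrite mulrAC -mulrA -sqr_sigma_hat -{}Zz real_normK ?num_real//.
by rewrite exprMn exprVn divfK ?expf_neq0// exprMn sqr_sqrtr ?ler0n ?subrr.
Qed.

Lemma Zstat_ge_contrast (R : realType) n K (X : 'M[R]_(n, K)) beta0 k z e :
  (K < n)%N -> X^T *m X = n%:R%:M -> 0 < rss X (resp X beta0 e) ->
  0 < contrast X beta0 k z e -> z <= `|Zstat X (resp X beta0 e) k|.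
Proof.
move=> Kn XX; have n0 : (0 < n)%N by exact: leq_ltn_trans Kn.
rewrite ZstatE// /contrast; set Y := resp _ _ _ => r0.
rewrite mulrAC -mulrA -sqr_sigma_hat subr_gt0.
have s0 : 0 < sigma_hat X Y by rewrite sqrtr_gt0 divr_gt0// ltr0n subn_gt0.
rewrite normrM normfV (gtr0_norm s0) ler_pdivlMr// => H.
(* [z] may be negative, hence the passage to absolute values before comparing squares. *)
apply: le_trans (ler_norm _) _; rewrite -ler_sqr ?nnegrE//.
rewrite !real_normK ?num_real// !exprMn (sqr_sqrtr (ler0n R n)).
exact: ltW.
Qed.

(** The zero extension matches the base point at which [noise_prob] freezes the coordinates from [n]
    on. *)
Definition noise_of (R : realType) n (v : 'cV[R]_n) : nat -> R :=
  fun i => if insub i is Some i' then v i' 0 else 0.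

Lemma noise_of_ge (R : realType) n (v : 'cV[R]_n) i :
  (n <= i)%N -> noise_of v i = 0.
Proof. by move=> ni; rewrite /noise_of insubF// ltnNge ni. Qed.

Lemma resp_noise_of (R : realType) n K (X : 'M[R]_(n, K)) beta0 (v : 'cV[R]_n) :
  resp X beta0 (noise_of v) = X *m beta0 + v.
Proof.
apply/matrixP => i j; rewrite !mxE ord1 /noise_of.
by rewrite insubT//= => ni; congr (_ + v _ _); exact: val_inj.
Qed.

(** A component orthogonal to the columns of [X] is invisible to OLS, so coefficients and residual
    can be prescribed independently. *)
Lemma ols_fit (R : realType) n K (X : 'M[R]_(n, K)) (b : 'cV[R]_K) (v : 'cV[R]_n) :
  (0 < n)%N -> X^T *m X = n%:R%:M -> X^T *m v = 0 ->
  ols X (X *m b + v) = b.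
Proof.
move=> n0 XX Xv; rewrite olsE// mulmxDr Xv addr0 mulmxA XX mul_scalar_mx.
by rewrite scalerA mulVf ?scale1r// pnatr_eq0 -lt0n.
Qed.

Lemma Zstat_atomless (R : realType) n K (X : 'M[R]_(n, K)) (beta0 : 'cV[R]_K) k (s z : R) :
  (0 < n)%N -> X^T *m X = n%:R%:M -> beta0 k 0 != 0 -> 0 < z ->
  noise_measure n s [set e | `|Zstat X (resp X beta0 e) k| = z] = 0%E.
Proof.
move=> n0 XX bk z0.
apply: (@noise_measure_poly_eq0 R n s (contrast X beta0 k z) _ (noise_of 0)).
- rewrite -[X in measurable X]setTI.
  exact: (measurable_norm_Zstat beta0 k n0 XX measurableT (measurable_set1 z)).
- exact: (coord_regular_contrast X beta0 k z).1.
- by move=> e; exact: Zstat_eq_contrast0.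
- by move=> i; exact: noise_of_ge.
- rewrite /contrast /rss resp_noise_of ols_fit ?mulmx0//.
  rewrite addr0 subrr big1 => [|i _]; last by rewrite mxE expr0n.
  by rewrite mulr0 subr0 mulf_neq0 ?expf_neq0// pnatr_eq0 -lt0n.
Qed.

Lemma exists_orthogonal (R : realType) n K (X : 'M[R]_(n, K)) : (K < n)%N ->
  exists2 v : 'cV[R]_n, X^T *m v = 0 & v != 0.
Proof.
move=> Kn; have : kermx X != 0.
  by rewrite -mxrank_eq0 mxrank_ker subn_eq0 -ltnNge (leq_ltn_trans (rank_leq_col X)).
move=> /rowV0Pn[u /sub_kermxP uX u0]; exists u^T; last first.
  by rewrite -(inj_eq trmx_inj) trmxK trmx0.
by rewrite -trmx_mul uX trmx0.
Qed.

(** One noise vector with [rss] and [contrast] both positive is enough: these conditions are open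
    along each coordinate and imply the event. *)
Lemma Zstat_tail_gt0 (R : realType) n K (X : 'M[R]_(n, K)) (beta0 : 'cV[R]_K) k (s b : R) :
  (K < n)%N -> X^T *m X = n%:R%:M -> 0 < s ->
  (0 < noise_measure n s [set e | b <= `|Zstat X (resp X beta0 e) k| ]%R)%E.
Proof.
move=> Kn XX s0; have n0 : (0 < n)%N by exact: leq_ltn_trans Kn.
pose A : set (seqR R) := [set e | 0 < rss X (resp X beta0 e)] `&`
  [set e | 0 < contrast X beta0 k b e].
have mpos (q : seqR R -> R) : coord_regular q -> measurable [set e | 0 < q e].
  move=> [_ mq]; rewrite -[X in measurable X]setTI.
  have -> : [set e | 0 < q e] = q @^-1` `]0, +oo[.
    by apply/seteqP; split => e /=; rewrite in_itv/= andbT.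
  exact: mq.
have mA : measurable A.
  apply: measurableI; apply: mpos; first exact: coord_regular_rss.
  exact: coord_regular_contrast.
have mZ : measurable [set e : seqR R | b <= `|Zstat X (resp X beta0 e) k|].
  by apply: measurable_ge_set; exact: measurable_norm_Zstat.
apply: (@lt_le_trans _ _ (noise_measure n s A)); last first.
  by apply: le_measure; rewrite ?inE// => e [? ?]; exact: Zstat_ge_contrast.
have [v Xv v0] := exists_orthogonal X Kn.
have vv0 : 0 < \sum_i v i 0 ^+ 2.
  rewrite lt0r sumr_ge0 ?andbT => [|i _]; last exact: sqr_ge0.
  apply: contra v0; rewrite psumr_eq0 => [/allP vi0|i _]; last exact: sqr_ge0.
  apply/eqP/matrixP => i j; rewrite ord1 mxE; apply/eqP.
  by have := vi0 i (mem_index_enum _); rewrite sqrf_eq0.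
(* The residual term of [contrast] when the residual is [v]. The noise below makes the response
   [X *m w + v], so every OLS coordinate is [c + 1], and [n (c + 1)^2 > c]. *)
pose c := b ^+ 2 / (n - K)%:R * \sum_i v i 0 ^+ 2.
have c0 : 0 <= c by rewrite mulr_ge0 ?divr_ge0 ?sqr_ge0 ?ler0n// ltW.
pose w : 'cV[R]_K := const_mx (c + 1).
apply: (@noise_measure_gt0 R n s A (noise_of (X *m (w - beta0) + v))) => //.
- move=> e j [h1 h2]; apply: filterI.
    exact: (coord_regular_gt0_near j (coord_regular_rss X beta0) h1).
  exact: (coord_regular_gt0_near j (coord_regular_contrast X beta0 k b) h2).
- by move=> i; exact: noise_of_ge.
- have rE : resp X beta0 (noise_of (X *m (w - beta0) + v)) = X *m w + v.
    by rewrite resp_noise_of mulmxBr addrA [X *m beta0 + _]addrC subrK.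
  rewrite /A /= /contrast /rss rE ols_fit// addrAC subrr add0r; split => //.
  rewrite mxE -/c subr_gt0.
  have n1 : 1 <= n%:R :> R by rewrite ler1n.
  nra.
Qed.

(** * Comparison of the risks *)

Lemma decreasing_prob_lt (R : realType) (d : measure_display)
    (T : measurableType d) (P : probability T R) (F : nat -> set T) (eps : R) :
  (forall m, measurable (F m)) -> nonincreasing_seq F ->
  P (\bigcap_m F m) = 0%E -> 0 < eps -> exists m, (P (F m) < eps%:E)%E.
Proof.
move=> mF niF F0 e0.
have : P \o F @ \oo --> P (\bigcap_m F m).
  apply: nonincreasing_cvg_mu => //; last exact: bigcapT_measurable.
  by rewrite (le_lt_trans (probability_le1 _ _)) ?ltry.
rewrite F0 => /fine_cvgP[_ /cvgrPdist_lt/(_ _ e0)[m _ /(_ m (leqnn m))]] /=.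
rewrite sub0r normrN => H; exists m; rewrite -[P (F m)]fineK ?fin_num_measure//.
by rewrite lte_fin (le_lt_trans (ler_norm _)).
Qed.

Lemma prob_tail_lt (R : realType) (d : measure_display)
    (T : measurableType d) (P : probability T R) (W : T -> R) (a eps : R) :
  measurable_fun setT W -> 0 < a -> 0 < eps ->
  exists m : nat, (P [set x | a * m.+1%:R <= W x]%R < eps%:E)%E.
Proof.
move=> mW a0 e0; apply: (decreasing_prob_lt (F := fun m => [set x | a * m.+1%:R <= W x])) => //.
- by move=> m; exact: measurable_ge_set.
- move=> m m' mm'; apply/subsetPset => x /=; apply: le_trans.
  by rewrite ler_pM2l// ler_nat.
- rewrite (_ : \bigcap_m _ = set0) ?measure0//.
  rewrite -subset0 => x /= /(_ (Num.truncn (`|W x| / a)) I) /=.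
  rewrite leNgt -ltr_pdivrMl// => /negP; apply.
  rewrite mulrC (@le_lt_trans _ _ (`|W x| / a)) ?truncnS_gt//.
  by rewrite ler_pM2r ?invr_gt0// ler_norm.
Qed.

(* Dini-type argument: by compactness of [a, b], the absence of atoms makes
   the mass of a short window small uniformly in its position. *)
Lemma prob_window_uniform (R : realType) (d : measure_display)
    (T : measurableType d) (P : probability T R) (W : T -> R) (a b eps : R) :
  measurable_fun setT W -> 0 < a -> 0 < eps ->
  (forall z, 0 < z -> P [set x | W x = z] = 0%E) ->
  exists m : nat, forall z, a <= z <= b ->
    (P [set x | z <= W x < z * (1 + m.+1%:R^-1)]%R <= eps%:E)%E.
Proof.
move=> mW a0 e0 W0.
have mwin (I : interval R) : measurable (W @^-1` [set` I]).
  by rewrite -[X in measurable X]setTI; exact: mW.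
have /compact_near_coveringP cov := @segment_compact R a b.
have := cov nat \oo (fun m z =>
  (P [set x | z <= W x < z * (1 + m.+1%:R^-1)]%R <= eps%:E)%E) _ _.
move=> H; have {H}[|m _ /(_ m (leqnn m)) H] := H; last first.
  by exists m => z zab; apply: H; rewrite /= in_itv/=.
move=> z /=; rewrite in_itv/= => /andP[az zb].
have z0 : 0 < z by exact: lt_le_trans az.
pose F (m : nat) := W @^-1` `[z - m.+1%:R^-1, z + m.+1%:R^-1].
have [||||m0] := @decreasing_prob_lt R d T P F eps => //.
- by move=> m; exact: mwin.
- move=> m m' mm'; apply/subsetPset => x /=; rewrite /F/= !in_itv/=.
  have : m'.+1%:R^-1 <= m.+1%:R^-1 :> R by rewrite lef_pV2 ?posrE// ler_nat.
  move: (m.+1%:R^-1) (m'.+1%:R^-1) => u v ? /andP[? ?].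
  by apply/andP; split; lra.
- rewrite -[RHS](W0 z z0); congr (P _); apply/seteqP; split => x; last first.
    move=> /= Wx m _; rewrite /F/= in_itv/= Wx.
    have : 0 < m.+1%:R^-1 :> R by rewrite invr_gt0.
    by move: (m.+1%:R^-1) => u ?; apply/andP; split; lra.
  move=> Fx /=; apply/eqP; rewrite -subr_eq0 -normr_le0.
  apply/ler_addgt0Pl => e e0'; rewrite addr0.
  have := Fx (Num.truncn e^-1) I; rewrite /F/= in_itv/=.
  have : (Num.truncn e^-1).+1%:R^-1 < e.
    by rewrite invf_plt ?posrE// truncnS_gt.
  move: (_.+1%:R^-1) => u h3 /andP[h1 h2].
  by rewrite ler_norml; apply/andP; split; lra.
move=> Pm0; set r : R := m0.+1%:R^-1 in Pm0.
have r0 : 0 < r by rewrite invr_gt0.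
have r1 : r <= 1 by rewrite invf_le1// ler1n.
(* As [r <= 1], a [z'] within [r / 2] of [z] is below [z + 1]; for such [m] the width [z' / (m + 1)]
   is at most [r / 2], so the window at [z'] lies inside [F m0]. *)
exists (ball z (r / 2), [set m : nat | 2 * (z + 1) / r <= m%:R]).
  split => /=; first by apply: nbhsx_ballx; lra.
  exact: nbhs_infty_ger.
move=> [z' m] [/= z'z mr].
have {}z'z : `|z - z'| < r / 2 by [].
rewrite ltr_norml in z'z; case/andP: z'z => z1 z2.
apply: le_trans (ltW Pm0); apply: le_measure; rewrite ?inE.
- rewrite (_ : [set x | _] = W @^-1` `[z', z' * (1 + m.+1%:R^-1)[).
    exact: mwin.
  by apply/seteqP; split => x /=; rewrite in_itv.
- exact: mwin.
move=> x; rewrite /F /= in_itv/= -/r.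
have : z' * m.+1%:R^-1 <= r / 2.
  rewrite ler_pdivrMr// mulrAC ler_pdivlMr//.
  move: mr; rewrite ler_pdivrMr// => mr; rewrite -natr1; nra.
move: (m.+1%:R^-1) => u h3 /andP[h1 h2]; rewrite mulrDr mulr1 in h2.
by apply/andP; split; lra.
Qed.

(** Shrinking the statistic by [d = g / (1 + g)] is raising the threshold to [z / d], and
    [1 / d = 1 + 1 / g]. *)
Lemma shrink_ge_scaled (R : realType) (g x z : R) : 0 < g ->
  (z <= `|g / (1 + g) * x|) = (z * (1 + g^-1) <= `|x|).
Proof.
move=> g0; have g1 : 0 < 1 + g by lra.
have -> : z * (1 + g^-1) = z / (g / (1 + g)).
  by field; rewrite !gt_eqF.
by rewrite normrM gtr0_norm ?divr_gt0// ler_pdivrMr ?divr_gt0// mulrC.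
Qed.

Lemma shrink_null_gain (R : realType) (d : measure_display)
    (T : measurableType d) (P : probability T R) (Z : T -> R) (a b : R) :
  measurable_fun setT (fun x => `|Z x|) -> 0 < a ->
  (0 < P [set x | b <= `|Z x|]%R)%E ->
  exists g eps : R, [/\ 0 < g, 0 < eps & forall z, a <= z <= b ->
    (P [set x | z <= `|g / (1 + g) * Z x|]%R + eps%:E <=
     P [set x | z <= `|Z x|]%R)%E].
Proof.
move=> mZ a0 pb.
have pf : P [set x | b <= `|Z x|] \is a fin_num.
  by apply: fin_num_measure; exact: measurable_ge_set.
(* Half the tail mass at [b]: for [z <= b] the unshrunk probability is at least [2 eps], and the
   shrunk one will be below [eps]. *)
pose eps := fine (P [set x | b <= `|Z x|]) / 2.
have e0 : 0 < eps by rewrite divr_gt0// fine_gt0// pb ltey_eq pf.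
have [m Pm] := prob_tail_lt P mZ a0 e0.
have g0 : 0 < m.+1%:R^-1 :> R by rewrite invr_gt0.
(* This [g] raises the threshold to [z (m + 2)], above [a (m + 1)]. *)
exists m.+1%:R^-1, eps; split => // z /andP[az zb].
apply: (@le_trans _ _ (P [set x | b <= `|Z x|])); last first.
  apply: le_measure; rewrite ?inE; [exact: measurable_ge_set..|].
  by move=> x /=; exact: le_trans.
rewrite -(fineK pf) (_ : fine _ = eps + eps); last by rewrite /eps; lra.
rewrite EFinD leeD2r//; apply: le_trans (ltW Pm).
under eq_set do rewrite shrink_ge_scaled// invrK.
apply: le_measure; rewrite ?inE; [exact: measurable_ge_set..|].
move=> x /=; apply: le_trans; apply: ler_pM => //; first exact: ltW.
by rewrite lerDr.
Qed.

Lemma shrink_alt_loss (R : realType) (d : measure_display)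
    (T : measurableType d) (P : probability T R) (Z : T -> R) (a b eps : R) :
  measurable_fun setT (fun x => `|Z x|) -> 0 < a -> 0 < eps ->
  (forall z, 0 < z -> P [set x | `|Z x| = z] = 0%E) ->
  exists g : R, 0 < g /\ forall z, a <= z <= b ->
    (P [set x | `|g / (1 + g) * Z x| < z]%R <=
     P [set x | `|Z x| < z]%R + eps%:E)%E.
Proof.
move=> mZ a0 e0 Z0; have [m Pm] := prob_window_uniform b mZ a0 e0 Z0.
have g0 : 0 < m.+1%:R :> R by rewrite ltr0n.
(* This [g] raises the threshold exactly to the upper end of the window bounded above, so the event
   grows by that window only. *)
exists m.+1%:R; split => // z zab.
have mwin : measurable [set x | z <= `|Z x| < z * (1 + m.+1%:R^-1)].
  rewrite (_ : [set x | _] = [set x | z <= `|Z x|] `&`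
     [set x | `|Z x| < z * (1 + m.+1%:R^-1)]); last first.
    by apply/seteqP; split => x /= => [/andP[]|[-> ->]].
  by apply: measurableI; [exact: measurable_ge_set|exact: measurable_lt_set].
apply: le_trans (leeD2l _ (Pm z zab)).
under eq_set do rewrite ltNge shrink_ge_scaled// -ltNge.
apply: le_trans (measureU2 _ _ _) => //; last exact: measurable_lt_set.
apply: le_measure; rewrite ?inE; first exact: measurable_lt_set.
  by apply: measurableU => //; exact: measurable_lt_set.
move=> x /= h; case: (ltP `|Z x| z) => hz; first by left.
by right; rewrite h.
Qed.

Lemma risk_Z_lt_risk_O (R : realType) (n K : nat) (X : 'M[R]_(n, K))
    (beta0 : 'cV[R]_K) (sigma0 delta : R) (k1 : 'I_K) :
  (K < n)%N -> X^T *m X = n%:R%:M -> 0 < sigma0 -> 0 < delta ->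
  beta0 k1 0 == 0 ->
  exists gamma : 'I_K -> R, (forall k, 0 < gamma k) /\
    forall alpha : R, delta <= alpha <= 1 - delta ->
      (risk_Z X beta0 sigma0 gamma alpha < risk_O X beta0 sigma0 alpha)%E.
Proof.
move=> Kn XX s0 d0 bk1.
have n0 : (0 < n)%N by exact: leq_ltn_trans Kn.
have [a [b [a0 zab]]] := z_half_bounds d0.
pose P := @noise_measure R n sigma0.
pose Z k (e : seqR R) := Zstat X (resp X beta0 e) k.
have mZ k : measurable_fun [set: seqR R] (fun e => `|Z k e|).
  exact: measurable_norm_Zstat.
have gain k : exists g eps : R, [/\ 0 < g, 0 < eps & forall z, a <= z <= b ->
    (P [set e | z <= `|g / (1 + g) * Z k e|]%R + eps%:E <=
     P [set e | z <= `|Z k e|]%R)%E].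
  by apply: shrink_null_gain => //; exact: Zstat_tail_gt0.
have [g1 [eps [g10 eps0 gain1]]] := gain k1.
pose eps' := eps / K.+1%:R.
have eps'0 : 0 < eps' by rewrite divr_gt0.
have loss k : beta0 k 0 != 0 -> exists g : R, 0 < g /\ forall z, a <= z <= b ->
    (P [set e | `|g / (1 + g) * Z k e| < z]%R <=
     P [set e | `|Z k e| < z]%R + eps'%:E)%E.
  by move=> bk; apply: shrink_alt_loss => // z z0; exact: Zstat_atomless.
(* At [k1] the choice must return [g1], whose gain fixed [eps] and thus [eps']; the other null
   coordinates are only asked not to lose. *)
have /choice[gamma hg] : forall k, exists g : R, [/\ 0 < g,
    (k == k1 -> g = g1),
    (beta0 k 0 == 0 -> forall z, a <= z <= b ->
       (P [set e | z <= `|g / (1 + g) * Z k e|]%R <=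
        P [set e | z <= `|Z k e|]%R)%E) &
    (beta0 k 0 != 0 -> forall z, a <= z <= b ->
       (P [set e | `|g / (1 + g) * Z k e| < z]%R <=
        P [set e | `|Z k e| < z]%R + eps'%:E)%E)].
  move=> k; have [bk|bk] := boolP (beta0 k 0 == 0); last first.
    have [g [g0 hg]] := loss k bk; exists g; split => // /eqP kk1.
    by rewrite kk1 bk1 in bk.
  have [kk1|kk1] := boolP (k == k1).
    exists g1; split => // _ z /gain1; rewrite (eqP kk1); apply: le_trans.
    by rewrite leeDl// lee_fin ltW.
  have [g [e [g0 e0 hg]]] := gain k; exists g; split => // _ z /hg; apply: le_trans.
  by rewrite leeDl// lee_fin ltW.
have g0 k : 0 < gamma k by have [] := hg k.
exists gamma; split => // alpha /zab; set z := z_half alpha => hz.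
rewrite /risk_Z /risk_O -/z.
pose x k := fine (P [set e | z <= `|gamma k / (1 + gamma k) * Z k e|]).
pose y k := fine (P [set e | z <= `|Z k e|]).
pose u k := fine (P [set e | `|gamma k / (1 + gamma k) * Z k e| < z]).
pose v k := fine (P [set e | `|Z k e| < z]).
have mgZ k : measurable_fun [set: seqR R]
    (fun e => `|gamma k / (1 + gamma k) * Z k e|).
  rewrite (_ : (fun e => _) =
    (fun e : seqR R => `|gamma k / (1 + gamma k)| * `|Z k e|)); last first.
    by apply/funext => e; rewrite normrM.
  by apply: measurable_funM; [exact: measurable_cst|exact: mZ].
have xE k : P [set e | z <= `|gamma k / (1 + gamma k) * Z k e|] = (x k)%:E.
  by rewrite fineK// fin_num_measure//; exact: measurable_ge_set.
have yE k : P [set e | z <= `|Z k e|] = (y k)%:E.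
  by rewrite fineK// fin_num_measure//; exact: measurable_ge_set.
have uE k : P [set e | `|gamma k / (1 + gamma k) * Z k e| < z] = (u k)%:E.
  by rewrite fineK// fin_num_measure//; exact: measurable_lt_set.
have vE k : P [set e | `|Z k e| < z] = (v k)%:E.
  by rewrite fineK// fin_num_measure//; exact: measurable_lt_set.
have bE k e : beta_star X beta0 gamma e k = gamma k / (1 + gamma k) * Z k e.
  exact: beta_starE.
rewrite (eq_bigr (fun k => (x k)%:E)) => [|k _]; last first.
  by rewrite -xE; congr noise_prob; apply/seteqP; split => e /=; rewrite bE.
rewrite [X in (_ + X < _)%E](eq_bigr (fun k => (u k)%:E)) => [|k _]; last first.
  by rewrite -uE; congr noise_prob; apply/seteqP; split => e /=; rewrite bE.
rewrite [X in (_ < X + _)%E](eq_bigr (fun k => (y k)%:E)) => [|k _]; last first.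
  by rewrite -yE.
rewrite [X in (_ < _ + X)%E](eq_bigr (fun k => (v k)%:E)) => [|k _]; last first.
  by rewrite -vE.
rewrite !sumEFin -!EFinD lte_fin.
have xy k : beta0 k 0 == 0 -> x k <= y k.
  by move=> bk; have [_ _ /(_ bk _ hz) + _] := hg k; rewrite xE yE lee_fin.
have xy1 : x k1 + eps <= y k1.
  have [_ gE _ _] := hg k1; have := gain1 z hz.
  by rewrite -(gE (eqxx _)) xE yE -EFinD lee_fin.
have uv k : beta0 k 0 != 0 -> u k <= v k + eps'.
  by move=> bk; have [_ _ _ /(_ bk _ hz)] := hg k; rewrite uE vE -EFinD lee_fin.
have sumx : \sum_(k < K | beta0 k 0 == 0) x k + eps <=
    \sum_(k < K | beta0 k 0 == 0) y k.
  rewrite (bigD1 k1)//= [leRHS](bigD1 k1)//= addrAC lerD//.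
  by apply: ler_sum => k /andP[/xy].
have sumu : \sum_(k < K | beta0 k 0 != 0) u k <=
    \sum_(k < K | beta0 k 0 != 0) v k + K%:R * eps'.
  apply: (@le_trans _ _ (\sum_(k < K | beta0 k 0 != 0) (v k + eps'))).
    by apply: ler_sum => k; exact: uv.
  rewrite big_split/= lerD2l big_mkcond/=.
  rewrite (_ : K%:R * eps' = \sum_(k < K) eps'); last first.
    by rewrite sumr_const card_ord mulr_natl.
  apply: ler_sum => k _.
  by case: ifP => // _; exact: ltW.
have : K%:R * eps' < eps.
  rewrite /eps' mulrCA gtr_pMr// ltr_pdivrMr// mul1r ltr_nat//.
lra.
Qed.

Local Close Scope classical_set_scope.

Theorem theorem5 (R : realType) (n K : nat) (X : 'M[R]_(n, K))
  (beta0 : 'cV[R]_K) (sigma0 : R) :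
  (1 <= K)%N -> (K < n)%N ->
  X^T *m X = n%:R%:M ->
  0 < sigma0 ->
  (0 < #|[set k : 'I_K | (beta0 k 0 != 0)%R]| < K)%N ->
  forall delta : R, 0 < delta < 1 / 2 ->
  exists gamma : 'I_K -> R, (forall k, 0 < gamma k) /\
    forall alpha : R, delta <= alpha <= 1 - delta ->
      (risk_Z X beta0 sigma0 gamma alpha < risk_O X beta0 sigma0 alpha)%E.
Proof.
move=> _ Kn XX s0 /andP[_ cK] delta /andP[d0 _].
(* Were no coordinate zero, the set of nonzero ones would be all of ['I_K], of cardinality [K]. *)
have [k1 bk1] : exists k1, beta0 k1 0 == 0.
  apply/existsP; apply: contraLR cK => /existsPn nb; rewrite -leqNgt.
  rewrite -[leqLHS]card_ord -cardsT subset_leq_card//.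
  by apply/fintype.subsetP => k _; rewrite inE nb.
exact: (risk_Z_lt_risk_O Kn XX s0 d0 bk1).
Qed.
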